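(* If a finite connected graph $G$ satisfies $\frac{\mu(G)}{\nu(G)}<1$, then $G$ contains a diamond spanner as a subgraph, i.e., for some integer $t\ge 0$, $G$ contains a subgraph isomorphic to the diamond spanner with $t$ diamonds.
   Context: All graphs are finite, simple, undirected and loopless. For a graph $G$, $\nu(G)$ is the maximum size of a matching in $G$. $\lambda(G)=\max\{|H|+|H'| : H,H' \text{ are disjoint matchings in } G\}$, $\Lambda(G)$ is the set of ordered pairs $(H,H')$ of disjoint matchings of $G$ with $|H|+|H'|=\lambda(G)$, and $\mu(G)=\max\{|H| : \text{there is } H' \text{ with } (H,H')\in\Lambda(G)\}$. A diamond is the graph $K_4$ minus one edge; its two vertices of degree $2$ are its tips. A leg attached at a vertex $c$ is a path $c\,x\,y$ where $x,y$ are new vertices. The diamond spanner with $t\ge 0$ diamonds is the graph consisting of two vertices $c_1,c_2$ (the central vertices), each with exactly two legs attached, together with $t$ vertex-disjoint diamonds $D_1,\dots,D_t$ with tips $s_i,t_i$ in $D_i$, and the edges $c_1s_1, t_1s_2, t_2s_3,\dots,t_{t-1}s_t, t_tc_2$ (for $t=0$ this is just the single edge $c_1c_2$); all listed vertices are distinct. The diamond spanner with $0$ diamonds is called the spanner (a tree on $10$ vertices). *)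

(* Defs.v *)
From mathcomp Require Import all_boot.

Set Implicit Arguments.
Unset Strict Implicit.
Unset Printing Implicit Defensive.

(* A finite simple graph is a symmetric irreflexive relation [e] on a finType;
   its edges are unordered pairs of vertices, so matchings are sets of 2-sets. *)

Section Matchings.
Variables (T : finType) (e : rel T).

Definition connected_graph : Prop := forall x y : T, connect e x y.

Definition edges : {set {set T}} := [set [set x; y] | x in T, y in T & e x y].

Definition matching (H : {set {set T}}) : bool :=
  (H \subset edges) && trivIset H.

Definition nu : nat := \max_(H : {set {set T}} | matching H) #|H|.

Definition disjoint_matchings (p : {set {set T}} * {set {set T}}) : bool :=
  [&& matching p.1, matching p.2 & [disjoint p.1 & p.2]].

Definition lambda : nat :=
  \max_(p : {set {set T}} * {set {set T}} | disjoint_matchings p)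
     (#|p.1| + #|p.2|).

Definition Lambda : {set {set {set T}} * {set {set T}}} :=
  [set p | disjoint_matchings p & #|p.1| + #|p.2| == lambda].

Definition mu : nat := \max_(p in Lambda) #|p.1|.

End Matchings.

(* Vertices of the diamond spanner with [t] diamonds, diamonds being numbered
   from 0. The two central vertices c_1, c_2 are [Center false], [Center true];
   the leg number [l] at [Center c] is the path
   [Center c], [LegMid c l], [LegEnd c l]; the diamond [i] has tips [TipS i],
   [TipT i] and degree-3 vertices [Inner i false], [Inner i true]. *)
Inductive spanner_vertex (t : nat) : Type :=
  | Center of bool
  | LegMid of bool & bool
  | LegEnd of bool & bool
  | TipS of 'I_t
  | TipT of 'I_t
  | Inner of 'I_t & bool.

(* Each edge is listed here in one direction only. *)
Definition spanner_arc (t : nat) (u v : spanner_vertex t) : bool :=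
  match u, v with
  | Center c, LegMid c' _ => c == c'
  | LegMid c l, LegEnd c' l' => (c == c') && (l == l')
  | TipS i, Inner j _ => i == j
  | Inner i _, TipT j => i == j
  | Inner i false, Inner j true => i == j
  | Center false, TipS i => i == 0 :> nat
  | TipT i, TipS j => j == i.+1 :> nat
  | TipT i, Center true => i.+1 == t
  | Center false, Center true => t == 0
  | _, _ => false
  end.

Definition diamond_spanner (t : nat) : rel (spanner_vertex t) :=
  fun u v => spanner_arc u v || spanner_arc v u.

(* The graph (T, e) has a (not necessarily induced) subgraph isomorphic to
   (V, h). *)
Definition contains_subgraph (V : Type) (h : rel V) (T : Type) (e : rel T) :
  Prop :=
  exists2 f : V -> T, injective f & forall u v, h u v -> e (f u) (f v).

(* Main.v *)
Require Import Defs.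
From mathcomp Require Import all_boot all_order all_algebra.
From mathcomp Require Import zify.
Import Order.TTheory GRing.Theory Num.Theory.

Set Implicit Arguments.
Unset Strict Implicit.
Unset Printing Implicit Defensive.

(* A matching is encoded as an involution of the vertex set that fixes exactly
   the unmatched vertices. Take (H, H') in Lambda with |H| = mu, and a matching M
   with |M| = nu, such that the number of vertices whose M-edge is not in H u H'
   is least.
   Exchanging one edge of H, H' or M for another shows that an endpoint x of an
   M-edge missed by H u H' is covered by both H and H', and that so are its H- and
   H'-neighbours. Thus x has two disjoint legs inside H u H', unless its component
   in H u H' is a 4-cycle.
   Let P be an H-augmenting path of H u M, from v to w. The component K of v in
   H u H' misses w, since otherwise swapping the colours on K would enlarge H.
   Where P leaves K for the last time there is a vertex of K with two legs in K,
   and the next vertex u of P is outside K. If u has two legs outside K, we have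
   found a spanner. Otherwise u lies on a 4-cycle of H u H', and either M joins the
   two neighbours of u on it, so that the 4-cycle spans a diamond, or M-edges
   provide two legs at u. In the diamond case add the 4-cycle to K and iterate. *)

(** * Orbits of a product of two involutions *)

Section DihedralOrbit.
Variables (T : finType) (p q : T -> T) (v : T).
Hypotheses (pK : involutive p) (qK : involutive q) (pv : p v = v).

Let g := p \o q.

Lemma dihedral_inj : injective g.
Proof. exact: inj_comp (inv_inj pK) (inv_inj qK). Qed.

Lemma dihedral_iter_inj k : injective (iter k g).
Proof. by elim: k => // k IHk; apply: inj_comp dihedral_inj IHk. Qed.

(** Conjugation by [p] inverts [g], so [p], which fixes [v], acts on the orbit of [v] as the
    reflection exchanging [g^k v] and [g^-k v]. *)
Lemma dihedral_iterK k : iter k g (p (iter k g v)) = v.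
Proof.
elim: k => [//|k IHk].
by rewrite iterSr iterS /g /= !pK qK.
Qed.

Lemma dihedral_fconnect_l y : fconnect g v y -> fconnect g v (p y).
Proof.
move/iter_findex; rewrite fconnect_sym; last exact: dihedral_inj.
move: (findex _ _ _) => k <-.
by rewrite -{2}(dihedral_iterK k) fconnect_iter.
Qed.

Lemma dihedral_fconnect_r y : fconnect g v y -> fconnect g v (q y).
Proof.
move=> vy; rewrite -[q y]pK; apply: dihedral_fconnect_l.
by apply: connect_trans vy _; apply: (fconnect1 g).
Qed.

Lemma dvdn_order_period k : iter k g v = v -> order g v %| k.
Proof.
have gK := iter_order dihedral_inj v.
have perK j : iter (j * order g v) g v = v.
  by elim: j => [//|j IHj]; rewrite mulSn iterD IHj.
rewrite {1}(divn_eq k (order g v)) addnC iterD perK => kv.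
have lt_k: k %% order g v < order g v by rewrite ltn_pmod ?order_gt0.
by have := findex_iter lt_k; rewrite kv findex0 /dvdn => <-.
Qed.

(** If [p] fixes [g^k v], then [g^(2k) v = v], so an odd period divides [k]. *)
Lemma dihedral_fixed_uniq y :
  odd (order g v) -> fconnect g v y -> p y = y -> y = v.
Proof.
move=> odd_o /iter_findex; move: (findex _ _ _) => k <- fix_y.
have := dihedral_iterK k; rewrite fix_y -iterD => /dvdn_order_period.
rewrite addnn -muln2 Gauss_dvdl ?coprimen2 // => /dvdnP[j ->].
elim: j => [//|j IHj].
by rewrite mulSn iterD IHj (iter_order dihedral_inj).
Qed.

(** Write [z = g^k v]. Then [p] maps [g^(k+1) v] to [g^k v], so the period divides [2k + 1]. *)
Lemma dihedral_fixed_odd z :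
  fconnect g v z -> q z = z -> odd (order g v).
Proof.
move=> /iter_findex; move: (findex _ _ _) => k <- fix_z.
have gz : p (iter k.+1 g v) = iter k g v by rewrite iterS /g /= pK.
have := dihedral_iterK k.+1; rewrite gz -iterD => /dvdn_order_period.
by move/dvdn_odd; apply; rewrite /= addnn odd_double.
Qed.

(** The orbit of [v] is an alternating path with end [v]. Halfway round the orbit lies its other
    end, free for [p] or [q] according to the parity of the period. *)
Lemma dihedral_half_l k : order g v = k.*2 -> p (iter k g v) = iter k g v.
Proof.
move=> oE; apply: (@dihedral_iter_inj k).
by rewrite dihedral_iterK -iterD addnn -oE (iter_order dihedral_inj).
Qed.

Lemma dihedral_half_r k :
  order g v = k.*2.+1 -> q (iter k g v) = iter k g v.
Proof.
move=> oE; rewrite -[q _]pK -[p (q _)]/(g _) -iterS.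
apply: (@dihedral_iter_inj k.+1).
by rewrite dihedral_iterK -iterD addSn addnn -oE (iter_order dihedral_inj).
Qed.

End DihedralOrbit.

(** * Matchings as involutions *)

Section Involutions.
Variables (T : finType) (e : rel T).
Hypotheses (e_sym : symmetric e) (e_irr : irreflexive e).

Implicit Types f p q m : T -> T.

Definition inv_matching f :=
  [forall x, (f (f x) == x) && ((f x == x) || e x (f x))].

Definition edge_disjoint p q := [forall x, (p x == q x) ==> (p x == x)].

Definition moved f := [set x | f x != x].

Lemma inv_matchingK f : inv_matching f -> involutive f.
Proof. by move=> /forallP fM x; case/andP: (fM x) => /eqP. Qed.

Lemma inv_matching_edge f x : inv_matching f -> f x != x -> e x (f x).
Proof. by move=> /forallP fM; case/andP: (fM x) => _ /orP[/eqP->|]; rewrite ?eqxx. Qed.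

Lemma edge_disjointP p q x : edge_disjoint p q -> p x = q x -> p x = x.
Proof. by move=> /forallP/(_ x)/implyP pq /eqP/pq/eqP. Qed.

Lemma edge_disjoint_sym p q : edge_disjoint p q = edge_disjoint q p.
Proof. by apply/eq_forallb => x; rewrite eq_sym; case: eqP => //= ->. Qed.

(** Adds the edge [xy] to the matching [f] after removing the edges of [f] at [x] and [y]. *)
Definition link f x y z :=
  if z == x then y else if z == y then x else
  if (z == f x) || (z == f y) then z else f z.

Lemma link_l f x y : link f x y x = y.
Proof. by rewrite /link eqxx. Qed.

Lemma link_r f x y : link f x y y = x.
Proof. by rewrite /link eqxx; case: eqP. Qed.

Lemma inv_matching_link f x y :
  inv_matching f -> e x y -> inv_matching (link f x y).
Proof.
move=> fM xy; have fK := inv_matchingK fM.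
apply/forallP => z.
have [->|zx] := eqVneq z x; first by rewrite link_l link_r eqxx xy orbT.
have [->|zy] := eqVneq z y; first by rewrite link_r link_l eqxx e_sym xy orbT.
rewrite /link (negPf zx) (negPf zy).
have [zf|/norP[zfx zfy]] := boolP ((z == f x) || (z == f y)).
  by rewrite (negPf zx) (negPf zy) zf !eqxx.
rewrite !(inv_eq fK) !fK (negPf zx) (negPf zy) (negPf zfx) (negPf zfy) eqxx /=.
by have [//|/(inv_matching_edge fM) ->] := eqVneq (f z) z; rewrite orbT.
Qed.

Lemma card_moved_link1 f x y : involutive f -> x != y ->
  f x = x -> f y != y -> #|moved (link f x y)| = #|moved f|.
Proof.
move=> fK xy fx fy; have fyx: f y != x by rewrite (inv_eq fK) fx eq_sym.
have ->: moved (link f x y) = x |: (moved f :\ f y).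
  apply/setP => z; rewrite !inE /link fx.
  have [->|zx] := eqVneq z x; first by rewrite eq_sym xy.
  have [->|zy] := eqVneq z y; first by rewrite xy eq_sym fy.
  by case: (eqVneq z (f y)) => /=; rewrite ?eqxx.
rewrite cardsU1 !inE fx eqxx andbF.
by rewrite [RHS](cardsD1 (f y)) inE fK (eq_sym y) fy.
Qed.

Lemma card_moved_link0 f x y : x != y ->
  f x = x -> f y = y -> #|moved (link f x y)| = #|moved f|.+2.
Proof.
move=> xy fx fy.
have ->: moved (link f x y) = x |: (y |: moved f).
  apply/setP => z; rewrite !inE /link fx fy.
  have [->|zx] := eqVneq z x; first by rewrite eq_sym xy.
  by have [->|zy] := eqVneq z y; first by rewrite xy.
by rewrite !cardsU1 !inE fx fy !eqxx (negPf xy).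
Qed.

Lemma edge_disjoint_link p q x y : involutive p -> involutive q ->
  edge_disjoint p q -> q x != y -> edge_disjoint (link p x y) q.
Proof.
move=> pK qK pq xy; apply/forallP => z; rewrite /link.
have [->|zx] := eqVneq z x; first by rewrite eq_sym (negPf xy).
have [->|zy] := eqVneq z y; first by rewrite eq_sym (inv_eq qK) eq_sym (negPf xy).
by case: ifP => // _; rewrite ?eqxx ?implybT //; apply: (forallP pq).
Qed.

(** * Exchange arguments for triples with fewest missed vertices *)

Definition missed p q m := [set x | [&& m x != x, m x != p x & m x != q x]].

Lemma missedC p q m : missed p q m = missed q p m.
Proof. by apply/setP => x; rewrite !inE [X in _ && X]andbC. Qed.

(* Minimality compares only triples with the same three sizes, which makes the
   notion symmetric in [p] and [q]. *)
Definition min_triple p q m :=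
  [/\ [/\ inv_matching p, inv_matching q, inv_matching m & edge_disjoint p q],
   forall p1 q1, inv_matching p1 -> inv_matching q1 -> edge_disjoint p1 q1 ->
     #|moved p1| + #|moved q1| <= #|moved p| + #|moved q|
 & forall p1 q1 m1, inv_matching p1 -> inv_matching q1 -> inv_matching m1 ->
     edge_disjoint p1 q1 -> #|moved p1| = #|moved p| ->
     #|moved q1| = #|moved q| -> #|moved m1| = #|moved m| ->
     #|missed p q m| <= #|missed p1 q1 m1|].

Lemma min_tripleC p q m : min_triple p q m -> min_triple q p m.
Proof.
case=> -[pM qM mM pq] max_pq min_pq; split.
- by rewrite edge_disjoint_sym.
- by move=> p1 q1 p1M q1M d1; rewrite addnC [leqRHS]addnC max_pq // edge_disjoint_sym.
move=> p1 q1 m1 p1M q1M m1M d1 c1 c2 c3; rewrite missedC [missed p1 _ _]missedC.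
by apply: min_pq => //; rewrite edge_disjoint_sym.
Qed.

(** Otherwise link [x] with [m x] in [p]: if [m x] is [p]-free the total grows, and if not the sizes
    stay while [x] stops being missed. *)
Lemma min_triple_free p q m x :
  min_triple p q m -> p x = x -> m x != x -> m x = q x.
Proof.
case=> -[pM qM mM pq] max_pq min_pq px mx; apply/eqP/contraT => mqx.
have [pK qK mK] : [/\ involutive p, involutive q & involutive m].
  by split; apply: inv_matchingK.
set y := m x in mx mqx *.
have xy : e x y := inv_matching_edge mM mx.
have my : m y = x by rewrite /y mK.
have x1M := inv_matching_link pM xy.
have d1 : edge_disjoint (link p x y) q by apply: edge_disjoint_link; rewrite // eq_sym.
have [py|py] := eqVneq (p y) y.
  have := max_pq _ _ x1M qM d1.
  by rewrite card_moved_link0 // ?(eq_sym x) // addSn; clear; lia.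
have := min_pq _ _ _ x1M qM mM d1.
rewrite card_moved_link1 // ?(eq_sym x) // => /(_ erefl erefl erefl).
rewrite leqNgt => /negP[]; apply: proper_card; apply/properP; split; last first.
  by exists x; rewrite !inE ?link_l ?eqxx ?andbF // -/y mx mqx px mx.
apply/subsetP => z; rewrite !inE => /and3P[mz mlz mqz]; rewrite mz mqz andbT /=.
apply: contraNneq mlz => mpz; rewrite /link.
have [->|zx] := eqVneq z x; first exact/eqP.
have [->|zy] := eqVneq z y; first exact/eqP.
(* Only [p y] loses its [p]-edge, and that edge is not in [m], which matches [y] with [x]. *)
rewrite px (negPf zx) /=; case: (z =P p y) => [zpy|_]; last exact/eqP.
by case/eqP: zx; rewrite -[z]mK mpz zpy pK my.
Qed.

(** A [q]-free [x] or a [p]-free [q x] is excluded by [min_triple_free]. If [q x] were [m]-free,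
    replacing the [m]-edge at [x] by its [q]-edge would leave fewer missed vertices. *)
Lemma min_triple_missed p q m x : min_triple p q m -> x \in missed p q m ->
  [/\ q x != x, m (q x) != q x & p (q x) != q x].
Proof.
move=> min3; have [[pM qM mM pq] _ min_pq] := min3.
have [pK qK mK] : [/\ involutive p, involutive q & involutive m].
  by split; apply: inv_matchingK.
rewrite inE => /and3P[mx mpx mqx].
have qx : q x != x.
  by apply: contraNneq mpx => /(min_triple_free (min_tripleC min3)) ->.
have mqx' : m (q x) != q x.
  apply/negP => /eqP mfix.
  have xqx : e (q x) x by rewrite e_sym inv_matching_edge.
  have m1M := inv_matching_link mM xqx.
  have := min_pq _ _ _ pM qM m1M pq erefl erefl.
  rewrite card_moved_link1 // => /(_ erefl).
  rewrite leqNgt => /negP[]; apply: proper_card; apply/properP; split; last first.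
    by exists x; rewrite !inE ?link_r ?eqxx ?andbF // mx mpx mqx.
  apply/subsetP => z; rewrite !inE /link mfix.
  have [->|_] := eqVneq z (q x); first by rewrite qK eqxx !andbF.
  have [->|_] := eqVneq z x; first by rewrite eqxx !andbF.
  by case: ifP; rewrite ?eqxx.
split=> //; apply: contraNneq mqx => pqx.
by rewrite (inv_eq mK) (min_triple_free min3 pqx mqx') qK.
Qed.

(** If every [p]-free [v] had odd period, sending [v] to the other end of its path would inject the
    [p]-free vertices into the [m]-free ones, against the sizes. With an even period the other end
    is [p]-free as well. *)
Lemma augmenting_walk p m : inv_matching p -> inv_matching m ->
  #|moved p| < #|moved m| ->
  exists v w n, [/\ p v = v, p w = w, w != v & w = m (iter n (p \o m) v)].
Proof.
move=> pM mM lt_pm; have [pK mK] := (inv_matchingK pM, inv_matchingK mM).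
have g_inj := dihedral_inj pK mK.
have [/existsP[v /andP[/eqP pv even_v]]|] :=
  boolP [exists v, (p v == v) && ~~ odd (order (p \o m) v)].
  have oE := even_halfK even_v; have o_gt0 := order_gt0 (p \o m) v.
  move: oE o_gt0; case: (_./2) => [<- //|k] oE _.
  (* This end is fixed by [p], so the last [p]-step is void and the walk stops with an [m]-step
     after [k] rounds. *)
  exists v, (iter k.+1 (p \o m) v), k; split=> //.
  - by apply: dihedral_half_l.
  - apply/eqP => kv; have := @findex_iter _ (p \o m) v k.+1.
    by rewrite kv findex0 -oE; lia.
  by rewrite -[LHS](dihedral_half_l pK mK pv (esym oE)) iterS /= pK.
move=> /existsPn all_odd.
have oddP v : p v = v -> odd (order (p \o m) v).
  by move=> pv; have := all_odd v; rewrite pv eqxx negbK.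
pose phi v := iter (order (p \o m) v)./2 (p \o m) v.
have phi_inj : {in ~: moved p &, injective phi}.
  move=> v v'; rewrite !inE !negbK => /eqP pv /eqP pv' phiE.
  apply: esym; apply: (dihedral_fixed_uniq pK mK pv (oddP _ pv)) => //.
  apply: connect_trans (fconnect_iter _ (order (p \o m) v)./2 _) _; rewrite -/(phi v) phiE.
  by rewrite fconnect_sym // fconnect_iter.
have : #|phi @: ~: moved p| <= #|~: moved m|.
  apply/subset_leq_card/subsetP => _ /imsetP[v pv ->].
  move: pv; rewrite !inE !negbK => /eqP pv; apply/eqP.
  apply: dihedral_half_r => //.
  by rewrite -[LHS]odd_double_half oddP.
rewrite card_in_imset //.
have := cardsC (moved p); have := cardsC (moved m); lia.
Qed.

(* [s] lists a centre followed by its two legs, each from the inside out. *)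
Definition legs (s : seq T) x0 :=
  [/\ e (nth x0 s 0) (nth x0 s 1), e (nth x0 s 1) (nth x0 s 2),
      e (nth x0 s 0) (nth x0 s 3) & e (nth x0 s 3) (nth x0 s 4)].

(** The excluded equality would close a 4-cycle. Any other coincidence among the five vertices
    yields a free vertex or a common edge of [p] and [q]. *)
Lemma min_triple_legs p q m x x0 :
  min_triple p q m -> x \in missed p q m -> p (q x) != q (p x) ->
  let s := [:: x; p x; q (p x); q x; p (q x)] in uniq s /\ legs s x0.
Proof.
move=> min3 miss_x pqx /=.
have [qx mqx pqx'] := min_triple_missed min3 miss_x.
have miss_x' : x \in missed q p m by rewrite missedC.
have [px mpx qpx'] := min_triple_missed (min_tripleC min3) miss_x'.
have [[pM qM mM pq] _ _] := min3.
have [pK qK] := (inv_matchingK pM, inv_matchingK qM).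
have px_qx : p x != q x by apply: contraNneq px => /(edge_disjointP pq) ->.
have edge f y : inv_matching f -> f y != y -> e y (f y).
  exact: inv_matching_edge.
split; last by split; apply: edge.
rewrite /= !inE !negb_or ![x == _]eq_sym px qx (eq_sym (p x)) qpx' px_qx.
rewrite (inv_eq qK) px_qx (inv_eq pK) (eq_sym (q x)) px_qx.
rewrite (inj_eq (inv_inj pK)) (eq_sym x) qx.
by rewrite (inj_eq (inv_inj qK)) px (eq_sym (q (p x))) pqx (eq_sym (q x)) pqx'.
Qed.

(** * Diamond spanners and augmenting walks *)

(* Indices 0 to 4 hold the first centre (at 4) and its legs, with middles at 1
   and 3; the diamond [i] takes the four indices from [4 * i + 5] to [4 * i + 8],
   its tips being the extreme ones. The vertex that the chain is extended from is thus always at [4 * t + 4]. *)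
Definition chain_edges (F : nat -> T) t :=
  [/\ e (F 4) (F 1), e (F 1) (F 0), e (F 4) (F 3), e (F 3) (F 2) &
  forall i, i < t ->
    [/\ e (F (4 * i + 4)) (F (4 * i + 5)),
        e (F (4 * i + 5)) (F (4 * i + 6)) /\ e (F (4 * i + 5)) (F (4 * i + 7)),
        e (F (4 * i + 6)) (F (4 * i + 7)) &
        e (F (4 * i + 6)) (F (4 * i + 8)) /\ e (F (4 * i + 7)) (F (4 * i + 8))]].

Lemma eq_chain_edges F F' t : (forall i, i < 4 * t + 5 -> F i = F' i) ->
  chain_edges F t -> chain_edges F' t.
Proof.
move=> eqF [e1 e2 e3 e4 ed].
have eq_leg k : k < 5 -> F k = F' k by move=> ?; apply: eqF; lia.
split; try by rewrite -!eq_leg.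
move=> i lt_it; have [d1 [d2 d3] d4 [d5 d6]] := ed i lt_it.
have eq_dia k : k < 9 -> F (4 * i + k) = F' (4 * i + k).
  by move=> lt_k; apply: eqF; clear -lt_k lt_it; lia.
by split; [|split| |split]; rewrite -!eq_dia.
Qed.

(** Positions in [L ++ s], where [L] is laid out as in [chain_edges] and [s], starting at
    [4 * t + 5], as in [legs]. *)
Definition spanner_index t (v : spanner_vertex t) : nat :=
  match v with
  | Center false => 4
  | LegMid false l => 2 * l + 1
  | LegEnd false l => 2 * l
  | TipS i => 4 * i + 5
  | Inner i l => 4 * i + (l + 6)
  | TipT i => 4 * i + 8
  | Center true => 4 * t + 5
  | LegMid true l => 4 * t + (2 * l + 6)
  | LegEnd true l => 4 * t + (2 * l + 7)
  end.

Lemma spanner_index_inj t : injective (@spanner_index t).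
Proof.
move=> [[]|[] []|[] []|i|i|i []] [[]|[] []|[] []|j|j|j []];
  cbn [spanner_index]; first [reflexivity | lia |
    by have := ltn_ord i; lia | by have := ltn_ord j; lia |
    by move=> ij; have -> : i = j by apply: ord_inj; lia].
Qed.

Lemma spanner_index_lt t (v : spanner_vertex t) : spanner_index v < 4 * t + 10.
Proof. by case: v => [[]|[] []|[] []|i|i|i []] /=; try have := ltn_ord i; lia. Qed.

Lemma contains_spanner x0 (L s : seq T) t :
  size L = 4 * t + 5 -> size s = 5 -> uniq (L ++ s) ->
  chain_edges (nth x0 L) t -> e (nth x0 L (4 * t + 4)) (nth x0 s 0) ->
  legs s x0 -> contains_subgraph (@diamond_spanner t) e.
Proof.
move=> sL ss uLs chL exit_s [s1 s2 s3 s4].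
set F := nth x0 (L ++ s).
have [e1 e2 e3 e4 ed] : chain_edges F t.
  by apply: eq_chain_edges chL => i lt_i; rewrite /F nth_cat sL lt_i.
have Fs k : F (4 * t + 5 + k) = nth x0 s k.
  by rewrite /F nth_cat sL ltnNge leq_addr /= addKn.
exists (F \o @spanner_index t).
  move=> u v /= /eqP; rewrite nth_uniq ?size_cat ?sL ?ss //.
  - by move=> /eqP/spanner_index_inj.
  - by have := spanner_index_lt u; clear; lia.
  - by have := spanner_index_lt v; clear; lia.
have arc u v : @spanner_arc t u v -> e (F (spanner_index u)) (F (spanner_index v)).
  have exitE : e (F (4 * t + 4)) (F (4 * t + 5)).
    by rewrite -[_ + 5]addn0 Fs /F nth_cat sL ltn_add2l.
  have leg1 : e (F (4 * t + 5)) (F (4 * t + 6)).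
    by rewrite -[_ + 5]addn0 -[_ + 6]/(_ + (5 + 1)) addnA !Fs.
  have leg2 : e (F (4 * t + 6)) (F (4 * t + 7)).
    by rewrite -[_ + 6]/(_ + (5 + 1)) -[_ + 7]/(_ + (5 + 2)) !addnA !Fs.
  have leg3 : e (F (4 * t + 5)) (F (4 * t + 8)).
    by rewrite -[_ + 5]addn0 -[_ + 8]/(_ + (5 + 3)) addnA !Fs.
  have leg4 : e (F (4 * t + 8)) (F (4 * t + 9)).
    by rewrite -[_ + 8]/(_ + (5 + 3)) -[_ + 9]/(_ + (5 + 4)) !addnA !Fs.
  have ord_ed (i : 'I_t) := ed i (ltn_ord i).
  case: u v => [[]|[] []|[] []|i|i|i []] [[]|[] []|[] []|j|j|j []];
    cbn [spanner_arc spanner_index] => //;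
    try (by move=> /eqP<-; have [_ [? ?] ? [? ?]] := ord_ed i).
  (* The four arcs left join positions [4 * i + 4] and [4 * i + 5]; those into the second centre are
     the exit edge [i = t]. *)
  - by move=> /eqP t0; move: exitE; rewrite t0.
  - by move=> /eqP j0; have [+ _ _ _] := ord_ed j; rewrite j0.
  - by move=> /eqP it; have -> : 4 * i + 8 = 4 * t + 4 by clear -it; lia.
  - move=> /eqP ji; have -> : 4 * i + 8 = 4 * j + 4 by clear -ji; lia.
    by have [] := ord_ed j.
by move=> u v /orP[/arc //|/arc]; rewrite /= e_sym.
Qed.

(** * Extending a chain of diamonds along the walk *)

Section Walk.
Variables (p q m : T -> T) (w : T).
Hypotheses (min3 : min_triple p q m) (pw : p w = w).

Let g := p \o m.

(** That is, [U] is a union of components of the union of [p] and [q]. *)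
Definition sealed (U : {set T}) :=
  forall z, (p z \in U) = (z \in U) /\ (q z \in U) = (z \in U).

(* [w] is the end of the alternating walk [c, m c, p (m c), ...], and the walk
   never visits [U] after its start [c]. *)
Definition last_exit (U : {set T}) c n :=
  [/\ c \in U, w \notin U, w = m (iter n g c) &
      forall j, 0 < j <= n -> iter j g c \notin U].

Lemma exists_last_exit (U : {set T}) c n :
  c \in U -> w \notin U -> w = m (iter n g c) ->
  exists2 k, k <= n & last_exit U (iter k g c) (n - k).
Proof.
move=> cU wU wE.
have exP : exists k, (k <= n) && (iter k g c \in U) by exists 0.
have leP k : (k <= n) && (iter k g c \in U) -> k <= n by case/andP.
case: (ex_maxnP exP leP) => k /andP[le_kn kU] max_k.
exists k => //; split=> //; first by rewrite -iterD subnK.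
move=> j /andP[j_gt0 le_j]; apply/negP; rewrite -iterD => jU.
by have := max_k (j + k); rewrite jU; lia.
Qed.

Lemma cross_missed U x : sealed U -> (m x \in U) != (x \in U) ->
  x \in missed p q m.
Proof.
move=> sU; have [pU qU] := sU x; rewrite inE => mU; apply/and3P.
by split; apply: contraNneq mU => ->; rewrite ?pU ?qU.
Qed.

(** Either [m c] is [w], or [p (m c)] is the next point of the walk and [p] preserves [U]. *)
Lemma last_exit_next U c n : sealed U -> last_exit U c n -> m c \notin U.
Proof.
move=> sU [cU wU wE out]; case: n wE out => [<- //|n] _ /(_ 1 isT) /=.
by rewrite (sU _).1.
Qed.

(** Induction on the number [n] of rounds left. The chain [L] stays inside [U] and ends at [c], so
    legs at [u = m c] that lie outside [U] avoid it. *)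
Lemma walk_spanner x0 n U c (L : seq T) t :
  sealed U -> last_exit U c n -> size L = 4 * t + 5 -> uniq L ->
  {subset L <= U} -> nth x0 L (4 * t + 4) = c -> chain_edges (nth x0 L) t ->
  exists t', contains_subgraph (@diamond_spanner t') e.
Proof.
elim/ltn_ind: n U c L t => n IHn U c L t sU exitU sL uL LU Lc chL.
have [[pM qM mM pq] _ _] := min3.
have [[pK qK] mK] := (inv_matchingK pM, inv_matchingK qM, inv_matchingK mM).
have uU := last_exit_next sU exitU; have [cU wU wE out] := exitU.
set u := m c in uU; have m_u : m u = c by rewrite /u mK.
have miss_u : u \in missed p q m.
  by apply: (cross_missed sU); rewrite m_u cU (negPf uU).
have uc : u != c by apply: contraNneq uU => ->.
have cu : e c u := inv_matching_edge mM uc.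
have [qu mqu pqu] := min_triple_missed min3 miss_u.
have miss_u' : u \in missed q p m by rewrite missedC.
have [pu mpu qpu] := min_triple_missed (min_tripleC min3) miss_u'.
have spanner s : uniq s -> ~~ has (mem U) s -> size s = 5 -> nth x0 s 0 = u ->
  legs s x0 -> exists t', contains_subgraph (@diamond_spanner t') e.
  move=> us sU' ss s0 leg_s; exists t.
  apply: (@contains_spanner x0 L s) => //; last by rewrite Lc s0.
  rewrite cat_uniq uL us andbT; apply: contra sU' => /hasP[z zs zL].
  by apply/hasP; exists z => //; apply: LU.
have outU z : z \notin U -> p z \notin U /\ q z \notin U.
  by rewrite (sU z).1 (sU z).2.
have [[puU quU]] := outU _ uU; have [_ qpuU] := outU _ puU.
have [pquU _] := outU _ quU.
have [pqu_eq|pqu_neq] := eqVneq (p (q u)) (q (p u)); last first.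
  have [us leg_s] := min_triple_legs x0 min3 miss_u pqu_neq.
  apply: spanner us _ _ _ leg_s => //=.
  by rewrite !negb_or uU puU quU qpuU pquU.
set a := p u in pu mpu qpu puU qpuU pqu_eq *.
set b := q u in qu mqu pqu quU pquU pqu_eq *.
set d := q a in qpu qpuU pqu_eq.
have [pa pb pd] : [/\ p a = u, p b = d & p d = b] by rewrite /a pK -pqu_eq pK.
have [qa qb qd] : [/\ q a = d, q b = u & q d = a] by rewrite /b /d !qK.
have ab : a != b.
  by apply: contraNneq pu => /(edge_disjointP pq) pu; rewrite -/a -pu.
have db : d != b by rewrite -pqu_eq.
have du : d != u by rewrite -qb (inj_eq (inv_inj qK)).
have ca : c != a by apply: contraNneq puU => <-.
have cb : c != b by apply: contraNneq quU => <-.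
have cd : c != d by apply: contraNneq qpuU => <-.
(* For [n = 0] the walk ends at [w = u], which is not [p]-free. *)
have n_gt0 : 0 < n.
  case: n {IHn exitU out} wE => // wE.
  by move: pw pu; rewrite wE /= -/u -/a => ->; rewrite eqxx.
have edge f y : inv_matching f -> f y != y -> e y (f y).
  exact: inv_matching_edge.
have [ua ub] : e u a /\ e u b by split; [apply: (edge p) | apply: (edge q)].
have ad : e a d := edge q a qM qpu.
have bd : e b d by rewrite -pb; apply: (edge p).
have gc : g c = a by [].
(* The 4-cycle is [u, a, d, b]. With the chord [ab] from [m] it spans a diamond with tips [u] and
   [d]. *)
have [mab|mab] := eqVneq (m a) b.
  pose U' := U :|: [set z in [:: u; a; b; d]].
  have inD z : z \in U' = (z \in U) || (z \in [:: u; a; b; d]) by rewrite !inE.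
  have sU' : sealed U'.
    move=> z; rewrite !inD (sU z).1 (sU z).2 !inE.
    rewrite !(inv_eq pK) !(inv_eq qK) pa pb pd qa qb qd -/a -/b.
    by split; congr (_ || _);
      case: (z == u); case: (z == a); case: (z == b); case: (z == d).
  have wU' : w \notin U'.
    rewrite inD (negPf wU) !inE /=; apply/negP.
    case/or4P => /eqP wD; move: pw; rewrite wD ?pa ?pb ?pd.
    - exact/eqP.
    - by move/esym/eqP; apply/negP.
    - exact/eqP.
    - by move/esym/eqP; apply/negP.
  have cU' : c \in U' by rewrite inD cU.
  have [k le_kn exitU'] := exists_last_exit cU' wU' wE.
  have [c'U' _ _ _] := exitU'; have := last_exit_next sU' exitU'.
  (* The last exit from [U'] is not at [c], as [m c = u] is in [U'], nor at [u], [a] or [b], whose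
     [m]-partners [c], [b], [a] are in [U']. Only the tip [d] remains. *)
  case: k le_kn exitU' c'U' => [|k] le_kn exitU' c'U'.
    by rewrite /= -/u inD !inE eqxx orbT.
  have := out k.+1 le_kn; set c' := iter k.+1 g c in exitU' c'U' *.
  move=> c'U; have mba : m b = a by rewrite -mab mK.
  move: (c'U'); rewrite inD (negPf c'U) !inE /=.
  case/or4P=> /eqP c'E; rewrite c'E ?m_u ?mab ?mba ?cU ?eqxx ?orbT // => _.
  rewrite c'E in exitU'.
  have nthD k' : nth x0 (L ++ [:: u; a; b; d]) (4 * t + (5 + k'))
      = nth x0 [:: u; a; b; d] k'.
    by rewrite addnA nth_cat sL ltnNge leq_addr /= addKn.
  have last_index : 4 * t.+1 + 4 = 4 * t + (5 + 3) by clear; lia.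
  apply: (IHn (n - k.+1) _ U' d (L ++ [:: u; a; b; d]) t.+1) => //.
  - by clear -n_gt0 le_kn; lia.
  - by rewrite size_cat sL /=; clear; lia.
  - rewrite cat_uniq uL /= !inE !negb_or (eq_sym u) pu (eq_sym u) qu.
    rewrite (eq_sym u) du ab (eq_sym a) qpu (eq_sym b) db !andbT.
    by apply/and4P; split; apply: contraNN (LU _) _.
  - move=> z; rewrite mem_cat inD => /orP[/LU ->//|->]; exact: orbT.
  - by rewrite last_index nthD.
  have [|e1 e2 e3 e4 ed] := @eq_chain_edges _ (nth x0 (L ++ [:: u; a; b; d])) t _ chL.
    by move=> i lt_i; rewrite nth_cat sL lt_i.
  split=> // i; rewrite ltnS leq_eqVlt => /predU1P[->|/ed //].
  rewrite (nthD 0) (nthD 1) (nthD 2) (nthD 3) /= nth_cat sL ltn_add2l /= Lc.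
  by split=> //; rewrite -mab; apply: (edge m).
have [mad|mad] := eqVneq (m a) d.
  have gb : iter 2 g c = b by rewrite /= /g /= -/u -/a mad.
  have bx : e b (m b) := edge m b mM mqu.
  apply: (spanner [:: u; a; d; b; m b]) => //.
  - rewrite /= !inE !negb_or (eq_sym u) pu (eq_sym u) du (eq_sym u) qu.
    rewrite (eq_sym a) qpu ab db (eq_sym b) mqu (eq_sym u) (eq_sym a) (eq_sym d).
    by rewrite !(inv_eq mK) m_u mad -mad mK mad (eq_sym b) cb (eq_sym b) db
         (eq_sym b) ab.
  rewrite /= !negb_or uU puU qpuU quU /= andbT.
  (* The walk runs through [a] and then [b]: after one round it would end at [w = d], which is not
     [p]-free. So [m b] is [w] or is mapped by [p] to the next point, hence outside [U]. *)
  case: n wE out n_gt0 {IHn exitU} => [|[|[|n]]] // wE out _.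
  - by move: pw; rewrite wE /= -/g gc mad pd => bd'; rewrite bd' eqxx in db.
  - by rewrite -gb -wE.
  by have := out 3 isT; rewrite iterS gb (sU _).1.
have ax : e a (m a) := edge m a mM mpu.
apply: (spanner [:: u; a; m a; b; d]) => //.
  rewrite /= !inE !negb_or (eq_sym u) pu (eq_sym u) (inv_eq mK) m_u (eq_sym a) ca.
  rewrite (eq_sym u) qu (eq_sym u) du (eq_sym a) mpu ab (eq_sym a) qpu.
  by rewrite mab mad (eq_sym b) db.
rewrite /= !negb_or uU puU qpuU quU /= !andbT.
(* Likewise [m a] is [w] or is mapped by [p] to the next point of the walk. *)
case: n wE out n_gt0 {IHn exitU} => [|[|n]] // wE out _; first by rewrite -gc -wE.
by have := out 2 isT; rewrite !iterS /= gc (sU _).1.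
Qed.

End Walk.

(** * Starting the chain in the component of a free vertex *)

Lemma edge_disjoint_swap p q (K : {set T}) :
  inv_matching p -> inv_matching q -> edge_disjoint p q ->
  (forall z, (p z \in K) = (z \in K)) -> (forall z, (q z \in K) = (z \in K)) ->
  let p1 z := if z \in K then q z else p z in
  let q1 z := if z \in K then p z else q z in
  [/\ inv_matching p1, inv_matching q1, edge_disjoint p1 q1 &
      #|moved p1| + #|moved q1| = #|moved p| + #|moved q|].
Proof.
move=> pM qM pq pK qK p1 q1; split.
- apply/forallP => z; rewrite /p1; have [zK|/negPf zK] := boolP (z \in K).
    by rewrite /= qK zK; apply: (forallP qM).
  by rewrite /= pK zK; apply: (forallP pM).
- apply/forallP => z; rewrite /q1; have [zK|/negPf zK] := boolP (z \in K).
    by rewrite /= pK zK; apply: (forallP pM).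
  by rewrite /= qK zK; apply: (forallP qM).
- apply/forallP => z; rewrite /p1 /q1; case: ifP => zK; last exact: (forallP pq).
  by move: pq; rewrite edge_disjoint_sym => /forallP.
have movedE f : #|moved f| = \sum_z (f z != z).
  by rewrite -sum1dep_card big_mkcond; apply: eq_bigr => z _; case: eqP.
rewrite !movedE -!big_split /=; apply: eq_bigr => z _.
by rewrite /p1 /q1; case: ifP => // _; rewrite addnC.
Qed.

Lemma min_triple_spanner p q m : min_triple p q m ->
  (forall p1 q1, inv_matching p1 -> inv_matching q1 -> edge_disjoint p1 q1 ->
     #|moved p1| + #|moved q1| = #|moved p| + #|moved q| ->
     #|moved p1| <= #|moved p|) ->
  #|moved p| < #|moved m| ->
  exists t, contains_subgraph (@diamond_spanner t) e.
Proof.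
move=> min3 max_p lt_pm; have [[pM qM mM pq] _ _] := min3.
have [pK qK] := (inv_matchingK pM, inv_matchingK qM).
have [v [w [n [pv pw wv wE]]]] := augmenting_walk pM mM lt_pm.
(* Since [p v = v], the orbit under [p \o q] is already closed under [p] and [q] separately, so [K]
   is a whole component. *)
pose K := [set z | fconnect (p \o q) v z].
have sK : sealed p q K.
  have pS z : z \in K -> p z \in K by rewrite !inE; apply: dihedral_fconnect_l.
  have qS z : z \in K -> q z \in K by rewrite !inE; apply: dihedral_fconnect_r.
  move=> z; split; apply/idP/idP => zK; rewrite ?pS ?qS //.
    by rewrite -[z]pK pS.
  by rewrite -[z]qK qS.
have vK : v \in K by rewrite inE connect0.
(* Otherwise the component [K] has two [p]-free ends, hence no [q]-free vertex,
   and swapping the colours on [K] enlarges the first matching. *)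
have wK : w \notin K.
  apply/negP; rewrite inE => vw.
  have even_o : ~~ odd (order (p \o q) v).
    by apply: contraNN wv => odd_o; rewrite (dihedral_fixed_uniq pK qK pv odd_o vw).
  have q_moves z : z \in K -> q z != z.
    rewrite inE => vz; apply: contraNneq even_o.
    by move=> qz; apply: dihedral_fixed_odd vz qz.
  have [p1M q1M d1 card1] := edge_disjoint_swap pM qM pq
    (fun z => (sK z).1) (fun z => (sK z).2).
  have := max_p _ _ p1M q1M d1 card1; rewrite leqNgt => /negP[].
  apply: proper_card; apply/properP; split.
    by apply/subsetP => z; rewrite inE => pz; rewrite inE; case: ifP => // /q_moves.
  by exists v; rewrite inE ?vK ?pv ?eqxx // q_moves.
have [k _ exitK] := exists_last_exit vK wK wE.
set c := iter k _ v in exitK; have mcK := last_exit_next sK exitK.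
have [cK _ _ _] := exitK.
have miss_c : c \in missed p q m.
  by apply: (cross_missed sK); rewrite (negPf mcK) cK.
have [qc _ pqc] := min_triple_missed min3 miss_c.
(* Equality would make the component of [c] a 4-cycle, on which [p] has no fixed point, but it
   contains [v]. *)
have pqc_neq : p (q c) != q (p c).
  apply/eqP => pqcE.
  have [pc _ _] : [/\ p c != c, m (p c) != p c & q (p c) != p c].
    by apply: min_triple_missed (min_tripleC min3) _; rewrite missedC.
  have orbit_c j : iter j (p \o q) c \in [:: c; p (q c)].
    elim: j => [|j]; first by rewrite mem_head.
    rewrite iterS !inE => /orP[] /eqP -> /=; rewrite ?eqxx ?orbT //.
    by rewrite {1}pqcE qK pK eqxx.
  have: fconnect (p \o q) c v.
    by rewrite fconnect_sym; [rewrite inE in cK | apply: dihedral_inj].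
  move/iter_findex; move: (findex _ _ _) => j vE.
  have := orbit_c j; rewrite vE !inE => /orP[] /eqP vE'.
    by move: pc; rewrite -vE' pv eqxx.
  have qcv : q c = v by rewrite -[q c]pK -vE'.
  by move: pqc; rewrite qcv pv eqxx.
have [us [l1 l2 l3 l4]] := min_triple_legs v min3 miss_c pqc_neq.
(* A chain without diamonds: each leg is read from its outer end, and the centre comes last, at
   index 4. *)
pose L := [:: q (p c); p c; p (q c); q c; c].
apply: (@walk_spanner _ _ _ _ min3 pw v _ K c L 0) => //; first exact: exitK.
- by apply: etrans us; apply: perm_uniq; apply/permP => f /=; clear; lia.
- apply/allP; rewrite /= cK !(sK _).1 !(sK _).2.
  by rewrite !(sK _).1 cK.
Qed.

End Involutions.

(** * Back to sets of edges *)

Section Partners.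
Variables (T : finType) (e : rel T).
Hypotheses (e_sym : symmetric e) (e_irr : irreflexive e).

Implicit Types (H : {set {set T}}) (f : T -> T).

Definition partner H x := odflt x [pick y | [set x; y] \in H].

Definition edge_set f : {set {set T}} := [set [set x; f x] | x in moved f].

Lemma mem_edges A : A \in edges e ->
  exists x y, [/\ A = [set x; y], e x y & x != y].
Proof.
case/imset2P => x y _; rewrite inE => /andP[_ xy] ->; exists x, y; split=> //.
by apply: contraTneq xy => ->; rewrite e_irr.
Qed.

Lemma edge_mem x y : e x y -> [set x; y] \in edges e.
Proof. by move=> xy; apply/imset2P; exists x y; rewrite ?inE. Qed.

Lemma set2_inj (x y z : T) : [set x; y] = [set x; z] -> y = z.
Proof.
move=> /setP E; have := E y; have := E z; rewrite !inE !eqxx !orbT.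
by move=> /orP[] /eqP-> // /esym/orP[] /eqP.
Qed.

Lemma matching_set2 H x y : matching e H -> [set x; y] \in H -> e x y /\ x != y.
Proof.
case/andP => /subsetP sHe _ /sHe/mem_edges[a [b [E ab nab]]].
have /set2P xab : x \in [set a; b] by rewrite -E set21.
case: xab => xE; subst x.
  by move/set2_inj: E => ->.
by move: E; rewrite (setUC [set a]) => /set2_inj ->; rewrite e_sym eq_sym.
Qed.

Lemma matching_set2_uniq H x y z :
  matching e H -> [set x; y] \in H -> [set x; z] \in H -> y = z.
Proof.
case/andP => _ /trivIsetP tH xy xz; apply: (@set2_inj x); apply/eqP/contraT.
by move=> /(tH _ _ xy xz)/pred0P/(_ x); rewrite /= !inE eqxx.
Qed.

Lemma partnerP H x : matching e H ->
  if partner H x == x then forall y, [set x; y] \notin H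
  else [set x; partner H x] \in H.
Proof.
rewrite /partner => HM; case: pickP => [y xy|none] /=; last by rewrite eqxx => y; rewrite none.
by have [_ /negPf] := matching_set2 HM xy; rewrite eq_sym => ->.
Qed.

Lemma partnerE H x y : matching e H -> [set x; y] \in H -> partner H x = y.
Proof.
move=> HM xy; have := partnerP x HM; case: ifP => [_ /(_ y)|_ xy'].
  by rewrite xy.
exact: matching_set2_uniq HM xy' xy.
Qed.

Lemma partner_mem H x : matching e H -> partner H x != x ->
  [set x; partner H x] \in H.
Proof. by move=> HM; have := partnerP x HM; case: ifP. Qed.

Lemma partner_inv_matching H : matching e H -> inv_matching e (partner H).
Proof.
move=> HM; apply/forallP => x; have [Hx|Hx] /= := eqVneq (partner H x) x.
  by rewrite Hx Hx eqxx.
have xy := partner_mem HM Hx; rewrite (matching_set2 HM xy).1 andbT.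
by rewrite [X in X == _](partnerE HM (y := x)) // setUC.
Qed.

Lemma edge_disjoint_partner H H' : matching e H -> matching e H' ->
  [disjoint H & H'] -> edge_disjoint (partner H) (partner H').
Proof.
move=> HM HM' /pred0P dH; apply/forallP => x; apply/implyP => /eqP E.
apply/contraT => Hx; have := dH [set x; partner H x].
by rewrite /= partner_mem // E partner_mem // -E.
Qed.

Lemma card_cover_matching H : matching e H -> #|cover H| = #|H|.*2.
Proof.
case/andP => /subsetP sHe /eqP <-; rewrite -muln2 -sum_nat_const.
by apply: eq_bigr => A /sHe/mem_edges[x [y [-> _ xy]]]; rewrite cards2 xy.
Qed.

(** The moved vertices are those covered by [H], so sizes double in passing to involutions. *)
Lemma card_moved_partner H : matching e H -> #|moved (partner H)| = #|H|.*2.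
Proof.
move=> HM; rewrite -card_cover_matching //; apply: eq_card => x; rewrite inE.
apply/idP/bigcupP => [/(partner_mem HM) xy|[A AH xA]].
  by exists [set x; partner H x]; rewrite ?set21.
have /andP[/subsetP/(_ _ AH)/mem_edges[a [b [AE ab nab]]] _] := HM.
rewrite AE in AH xA; case/set2P: xA => ->.
  by rewrite (partnerE HM AH) eq_sym.
by rewrite setUC in AH; rewrite (partnerE HM AH).
Qed.

Lemma edge_set_matching f : inv_matching e f -> matching e (edge_set f).
Proof.
move=> fM; have fK := inv_matchingK fM; apply/andP; split.
  apply/subsetP => _ /imsetP[x xf ->]; apply: edge_mem.
  by apply: (inv_matching_edge fM); rewrite inE in xf.
apply/trivIsetP => _ _ /imsetP[x _ ->] /imsetP[y _ ->].
apply: contraR => /pred0Pn[z /andP[]].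
by rewrite /= => /set2P[]-> /set2P[]; [move=> -> | move=> -> | move=> <- | move/(inv_inj fK) ->];
  rewrite ?fK // setUC.
Qed.

Lemma card_edge_set f : inv_matching e f -> #|edge_set f|.*2 = #|moved f|.
Proof.
move=> fM; have fK := inv_matchingK fM.
rewrite -card_cover_matching ?edge_set_matching //; apply: eq_card => x.
apply/bigcupP/idP => [[_ /imsetP[y yf ->]] /set2P[]->|xf] //.
  by move: yf; rewrite !inE fK eq_sym.
by exists [set x; f x]; rewrite ?set21 //; apply: imset_f.
Qed.

Lemma disjoint_edge_set f f' : inv_matching e f -> inv_matching e f' ->
  edge_disjoint f f' -> [disjoint edge_set f & edge_set f'].
Proof.
move=> fM fM' ff'; apply/pred0Pn => -[_ /andP[/imsetP[x xf ->]]] /=.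
case/imsetP => y yf' E.
have /set2P xy : x \in [set y; f' y] by rewrite -E set21.
have f'x : f x = f' x.
  case: xy => xE; first by move: E; rewrite -xE => /set2_inj.
  move: E; rewrite [in RHS]setUC {1}xE => /set2_inj ->.
  by rewrite xE (inv_matchingK fM').
by move: xf; rewrite inE (edge_disjointP ff' f'x) eqxx.
Qed.

End Partners.

(** * Choice of an extremal triple *)

Lemma bigmax_attained (I : finType) (A : pred I) (F : I -> nat) i0 :
  A i0 -> exists2 i, A i & \max_(i | A i) F i = F i.
Proof.
move=> Ai0; have A_gt0 : 0 < #|A| by apply/card_gt0P; exists i0.
by have [i Ai Fi] := eq_bigmax_cond F A_gt0; exists i.
Qed.

Lemma mu_lt_nu_spanner (T : finType) (e : rel T) :
  symmetric e -> irreflexive e -> mu e < nu e ->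
  exists t, contains_subgraph (@diamond_spanner t) e.
Proof.
move=> e_sym e_irr lt_mu_nu.
have matching0 : matching e set0.
  by rewrite /matching sub0set; apply/trivIsetP => A B; rewrite inE.
have [M MM nuE] := bigmax_attained (fun M : {set {set T}} => #|M|) matching0.
have disj0 : disjoint_matchings e (set0, set0).
  by rewrite /disjoint_matchings /= matching0 disjoints_subset sub0set.
have [P0 dP0 lamE] := bigmax_attained (fun P : {set {set T}} * {set {set T}} => #|P.1| + #|P.2|) disj0.
have P0L : P0 \in Lambda e by rewrite inE dP0 -lamE eqxx.
have [P PL muE] := bigmax_attained (fun P : {set {set T}} * {set {set T}} => #|P.1|) P0L.
have : P \in Lambda e := PL; rewrite inE => /andP[/and3P[HM HM' dH] /eqP cardP].
(* Finite functions make the triples a finite type, over which the number of missed vertices attains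
   its minimum. *)
pose good (s : {ffun T -> T} * {ffun T -> T} * {ffun T -> T}) :=
  [&& inv_matching e s.1.1, inv_matching e s.1.2, inv_matching e s.2,
      edge_disjoint s.1.1 s.1.2, #|moved s.1.1| == #|P.1|.*2,
      #|moved s.1.2| == #|P.2|.*2 & #|moved s.2| == #|M|.*2].
pose triple (p q m : T -> T) := (finfun p, finfun q, finfun m).
have goodE p q m : good (triple p q m) =
  [&& inv_matching e p, inv_matching e q, inv_matching e m,
      edge_disjoint p q, #|moved p| == #|P.1|.*2,
      #|moved q| == #|P.2|.*2 & #|moved m| == #|M|.*2].
  have imE f : inv_matching e (finfun f) = inv_matching e f.
    by apply: eq_forallb => x; rewrite !ffunE.
  have mvE f : moved (finfun f) = moved f by apply/setP => x; rewrite !inE ffunE.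
  have edE f f' : edge_disjoint (finfun f) (finfun f') = edge_disjoint f f'.
    by apply: eq_forallb => x; rewrite !ffunE.
  by rewrite /good /= !imE !mvE edE.
have good0 : good (triple (partner P.1) (partner P.2) (partner M)).
  rewrite goodE !(card_moved_partner e_sym e_irr) // !eqxx !andbT.
  by rewrite !partner_inv_matching // (edge_disjoint_partner e_sym e_irr).
pose size_missed (s : {ffun T -> T} * {ffun T -> T} * {ffun T -> T}) :=
  #|missed s.1.1 s.1.2 s.2|.
case: (arg_minnP size_missed good0) => -[[p q] m] good_pqm min_pqm.
have /and5P[/= pM qM mM pq /and3P[/eqP cp /eqP cq /eqP cm]] := good_pqm.
have lam_max p1 q1 : inv_matching e p1 -> inv_matching e q1 ->
    edge_disjoint p1 q1 -> disjoint_matchings e (edge_set p1, edge_set q1).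
  move=> p1M q1M d1; rewrite /disjoint_matchings /= !edge_set_matching //.
  exact: (disjoint_edge_set p1M q1M).
apply: (min_triple_spanner e_sym (p := p) (q := q) (m := m)).
- split=> //.
    move=> p1 q1 p1M q1M d1; rewrite cp cq -doubleD cardP.
    rewrite -!(card_edge_set e_irr) // -doubleD leq_double.
    exact: (leq_bigmax_cond
      (F := fun P : {set {set T}} * {set {set T}} => #|P.1| + #|P.2|) _ (lam_max _ _ p1M q1M d1)).
  move=> p1 q1 m1 p1M q1M m1M d1 c1 c2 c3.
  have := min_pqm (triple p1 q1 m1); rewrite goodE p1M q1M m1M d1 c1 c2 c3 cp cq cm.
  rewrite !eqxx => /(_ isT); congr (_ <= #|pred_of_set _|).
  by apply/setP => x; rewrite !inE !ffunE.
(* A pair with the same total lies in [Lambda], so its first matching has at most [mu] edges. *)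
- move=> p1 q1 p1M q1M d1 c1; rewrite cp -(card_edge_set e_irr) // leq_double.
  rewrite -muE.
  apply: (leq_bigmax_cond (F := fun P : {set {set T}} * {set {set T}} => #|P.1|)
                          (edge_set p1, edge_set q1)).
  change ((edge_set p1, edge_set q1) \in Lambda e).
  rewrite inE lam_max //= -(inj_eq double_inj) doubleD !(card_edge_set e_irr) //.
  by rewrite c1 cp cq -doubleD cardP.
by rewrite cp cm ltn_double -muE -nuE.
Qed.

Local Open Scope ring_scope.

Theorem theorem1p2 (T : finType) (e : rel T)
    (e_sym : symmetric e) (e_irr : irreflexive e)
    (e_conn : connected_graph e)
    (nu_gt0 : (0 < nu e)%N)
    (ratio_lt1 : (mu e)%:R / (nu e)%:R < 1 :> rat) :
  exists t : nat, contains_subgraph (@diamond_spanner t) e.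
Proof.
apply: mu_lt_nu_spanner => //.
by move: ratio_lt1; rewrite ltr_pdivrMr ?ltr0n // mul1r ltr_nat.
Qed.
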